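(* Let $\mathcal{B}=\{b_1,\dots,b_K\}$ be a finite set of budgets, let $\mathrm{C}:\mathcal{B}\to\mathbb{R}$ be a cost function with $\mathrm{C}(b_1)\le\cdots\le \mathrm{C}(b_K)$, let $x_1,\dots,x_N\in\mathcal{X}$ be inputs, and let $\mathrm{Acc}:\mathcal{X}\times\mathcal{B}\to[0,1]$. Then there exists a deterministic tie-breaking rule for the selection $b^\star(x;\lambda)\in\operatorname{arg\,max}_{b\in\mathcal{B}}\,[\mathrm{Acc}(x,b)-\lambda\,\mathrm{C}(b)]$ ($x\in\mathcal{X}$, $\lambda\ge 0$) under which the average cost $$\bar{C}(\lambda)=\frac{1}{N}\sum_{i=1}^{N}\mathrm{C}\big(b^\star(x_i;\lambda)\big)$$ is a non-increasing function of $\lambda\in[0,\infty)$.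
   Context: $\mathcal{X}$ is the input space; $\mathrm{Acc}(x,b)\in[0,1]$ is the expected utility of input $x$ under budget $b$. For $\lambda\ge 0$, the oracle allocation $b^\star(x;\lambda)$ is an element of $\operatorname{arg\,max}_{b\in\mathcal{B}}[\mathrm{Acc}(x,b)-\lambda\,\mathrm{C}(b)]$; when the maximizer is not unique, a tie-breaking rule determines which maximizer is chosen. *)

(* Defs.v *)
From HB Require Import structures.
From mathcomp Require Import all_boot all_order all_algebra.
From mathcomp Require Import reals.
Set Implicit Arguments.
Unset Strict Implicit.
Unset Printing Implicit Defensive.
Import Order.TTheory GRing.Theory Num.Theory.
Local Open Scope ring_scope.

Definition argmax (R : realType) (B : finType) (f : B -> R) : {set B} :=
  [set b | [forall b' : B, f b' <= f b]].

(* A deterministic tie-breaking rule is a function of the set of tied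
   candidates; its value on the empty set is irrelevant. *)
Definition tie_breaking_rule (B : finType) (tau : {set B} -> B) : Prop :=
  forall A : {set B}, A != set0 -> tau A \in A.

Definition oracle_allocation (R : realType) (X : Type) (B : finType)
    (Acc : X -> B -> R) (C : B -> R) (tau : {set B} -> B)
    (x : X) (lambda : R) : B :=
  tau (argmax (fun b => Acc x b - lambda * C b)).

Definition average_cost (R : realType) (X : Type) (B : finType)
    (C : B -> R) (bstar : X -> R -> B) (N : nat) (x : 'I_N -> X)
    (lambda : R) : R :=
  N%:R^-1 * \sum_(i < N) C (bstar (x i) lambda).

(* Main.v *)
(* A maximizer at the larger multiplier never costs more than one at a strictly
   smaller multiplier: add the two optimality inequalities and divide by
   [lambda2 - lambda1 > 0]. Ties at a fixed multiplier are harmless because the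
   allocation is a function of the multiplier, so every tie-breaking rule
   works. *)

Require Import Defs.
From HB Require Import structures.
From mathcomp Require Import all_boot all_order all_algebra.
From mathcomp Require Import reals.
From mathcomp Require Import lra.
Set Implicit Arguments.
Unset Strict Implicit.
Unset Printing Implicit Defensive.
Import Order.TTheory GRing.Theory Num.Theory.
Local Open Scope ring_scope.

Lemma argmax_neq0 (R : realType) (B : finType) (b0 : B) (f : B -> R) :
  argmax f != set0.
Proof.
case: (@arg_maxP _ _ _ b0 xpredT f isT) => a _ a_max.
by apply/set0Pn; exists a; rewrite inE; apply/forallP => a'; exact: a_max.
Qed.

Lemma argmax_cost_le (R : realType) (B : finType) (f C : B -> R)
    (lambda1 lambda2 : R) (a1 a2 : B) :
  lambda1 < lambda2 ->
  a1 \in argmax (fun a => f a - lambda1 * C a) ->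
  a2 \in argmax (fun a => f a - lambda2 * C a) ->
  C a2 <= C a1.
Proof.
move=> lt12; rewrite !inE => /forallP/(_ a2) le1 /forallP/(_ a1) le2.
have dlt : 0 < lambda2 - lambda1 by rewrite subr_gt0.
(* Scaled by [lambda2 - lambda1], the goal is the sum of [le1] and [le2]: the values of [f] cancel,
   and the rest is linear in the products of a multiplier and a cost. *)
by rewrite -(ler_pM2l dlt); lra.
Qed.

Lemma exists_tie_breaking_rule (B : finType) (b0 : B) :
  exists tau : {set B} -> B, tie_breaking_rule tau.
Proof.
(* The default [b0] is returned only on the empty set. *)
exists (fun A : {set B} => odflt b0 [pick a in A]) => A /set0Pn[a aA].
by case: pickP => [//|/(_ a)]; rewrite aA.
Qed.

Theorem theorem1 (R : realType) (X : Type) (B : finType)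
    (K : nat) (K_gt0 : (0 < K)%N) (b : 'I_K -> B) (b_bij : bijective b)
    (C : B -> R)
    (C_mono : forall i j : 'I_K, (i <= j)%N -> C (b i) <= C (b j))
    (N : nat) (N_gt0 : (0 < N)%N) (x : 'I_N -> X)
    (Acc : X -> B -> R) (Acc01 : forall y a, 0 <= Acc y a <= 1) :
  exists tau : {set B} -> B,
    [/\ tie_breaking_rule tau,
        forall (y : X) (lambda : R), 0 <= lambda ->
          oracle_allocation Acc C tau y lambda
            \in argmax (fun a => Acc y a - lambda * C a)
      & forall lambda1 lambda2 : R, 0 <= lambda1 -> lambda1 <= lambda2 ->
          average_cost C (oracle_allocation Acc C tau) x lambda2
            <= average_cost C (oracle_allocation Acc C tau) x lambda1].
Proof.
pose b0 := b (Ordinal K_gt0).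
have [tau tauP] := exists_tie_breaking_rule b0.
have oracleP y lambda : oracle_allocation Acc C tau y lambda
    \in argmax (fun a => Acc y a - lambda * C a).
  exact/tauP/argmax_neq0.
exists tau; split=> // lambda1 lambda2 _.
(* Equal multipliers are split off because [argmax_cost_le] fails there: tied maximizers may differ
   in cost, but [tau] selects the same one on both sides. *)
rewrite le_eqVlt => /predU1P[-> //|lt12].
rewrite ler_wpM2l ?invr_ge0 ?ler0n //; apply: ler_sum => i _.
exact: argmax_cost_le lt12 (oracleP _ _) (oracleP _ _).
Qed.
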